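(* Let $I$ be an instance of Min d-BP with items $a_1,\ldots,a_n$. Suppose that for every dimension $i\in\{1,\ldots,d\}$ the Min BP instance $I_i$ has an equivalent graph $G_i=(V,E_i)$, where $V=\{v_1,\ldots,v_n\}$ and $v_j$ corresponds to item $a_j$. Let $G=(V,E_1\cap\cdots\cap E_d)$. Then $\mathrm{OPT}(I)\ge\omega(G)$.
   Context: Min d-BP: an instance consists of $n$ items $a_1,\ldots,a_n$, a number $d$ of dimensions and $n$ bins, each bin being the $d$-dimensional unit cube. Each item $a_j$ is a $d$-dimensional axis-parallel box with positive rational side length $s_{i,j}$ in dimension $i$. The task is to find $n$ pairwise disjoint (possibly empty) subsets of the items, covering all items, such that the items of each subset can be packed into a separate unit cube, and the number of non-empty subsets is minimized. Packing is without overlap and without rotation, with faces parallel to those of the cube. $\mathrm{OPT}(I)$ is this minimum. For dimension $i$, $I_i$ is the Min BP instance with items $a_1,\ldots,a_n$ and sizes $s_{i,1},\ldots,s_{i,n}$. A Min BP instance with sizes $s_1,\ldots,s_n$ and a graph $H$ are equivalent if there is a bijection $f$ from items to vertices of $H$ such that for every item subset $A'$ the characteristic vector $(x_1,\ldots,x_n)$ of $A'$ satisfies $s_1x_1+\cdots+s_nx_n\le1$ if and only if $f(A')$ is independent in $H$. $\omega(G)$ is the size of a largest clique of $G$. *)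

(* Defs.v *)
From HB Require Import structures.
From mathcomp Require Import all_boot all_order all_algebra.
From mathcomp Require Import boolp classical_sets reals.

Set Implicit Arguments.
Unset Strict Implicit.
Unset Printing Implicit Defensive.

Import Order.TTheory GRing.Theory Num.Theory.
Local Open Scope ring_scope.

Record sgraph (V : finType) := SGraph {
  adj : rel V;
  adj_sym : symmetric adj;
  adj_irrefl : irreflexive adj
}.

Definition independent (V : finType) (H : sgraph V) (A : {set V}) : bool :=
  [forall u in A, forall w in A, ~~ adj H u w].

Definition clique (V : finType) (H : sgraph V) (K : {set V}) : bool :=
  [forall u in K, forall w in K, (u != w) ==> adj H u w].

Definition clique_number (V : finType) (H : sgraph V) : nat :=
  \max_(K : {set V} | clique H K) #|K|.

Section EdgeIntersection.
Variables (V : finType) (d : nat) (d_gt0 : (0 < d)%N) (G : 'I_d -> sgraph V).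

Definition inter_adj : rel V := fun u w => [forall i, adj (G i) u w].

Fact inter_adj_sym : symmetric inter_adj.
Proof. by move=> u w; apply: eq_forallb => i; rewrite adj_sym. Qed.

Fact inter_adj_irrefl : irreflexive inter_adj.
Proof. by move=> u; apply/forallP => /(_ (Ordinal d_gt0)); rewrite adj_irrefl. Qed.

(* An empty intersection would contain loops, hence the assumption 0 < d. *)
Definition inter_graph : sgraph V := SGraph inter_adj_sym inter_adj_irrefl.

End EdgeIntersection.

Record bp_instance (n : nat) := BPInstance {
  bp_size : 'I_n -> rat;
  bp_size_gt0 : forall j, 0 < bp_size j
}.

Definition equivalent_via (n : nat) (J : bp_instance n)
    (V : finType) (H : sgraph V) (f : 'I_n -> V) : Prop :=
  bijective f /\
  forall A : {set 'I_n},
    \sum_(j < n) bp_size J j * (j \in A)%:R <= 1 <->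
    independent H [set f j | j in A].

(* Sides larger than 1 are allowed; an instance with such an item is
   infeasible. *)
Record dbp_instance (n d : nat) := DBPInstance {
  side : 'I_d -> 'I_n -> rat;
  side_gt0 : forall i j, 0 < side i j
}.

Definition dim_instance (n d : nat) (I : dbp_instance n d) (i : 'I_d) :
  bp_instance n := BPInstance (side_gt0 I i).

Section Packing.
Variables (R : realType) (n d : nat) (I : dbp_instance n d).

Definition unit_cube : set 'rV[R]_d :=
  [set x | forall i, 0 <= x 0 i <= 1]%classic.

(* item_box j p is item j placed, unrotated, with lowest corner p. *)
Definition item_box (j : 'I_n) (p : 'rV[R]_d) : set 'rV[R]_d :=
  [set x | forall i, p 0 i <= x 0 i <= p 0 i + ratr (side I i j)]%classic.

Definition item_box_interior (j : 'I_n) (p : 'rV[R]_d) : set 'rV[R]_d :=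
  [set x | forall i, p 0 i < x 0 i < p 0 i + ratr (side I i j)]%classic.

(* Packed boxes may touch along their boundaries. *)
Definition packable (A : {set 'I_n}) : Prop :=
  exists p : 'I_n -> 'rV[R]_d,
    (forall j, j \in A -> item_box j (p j) `<=` unit_cube)%classic /\
    (forall j k, j \in A -> k \in A -> j != k ->
       item_box_interior j (p j) `&` item_box_interior k (p k) = set0)%classic.

Definition bin_packing (B : 'I_n -> {set 'I_n}) : Prop :=
  [/\ forall k l, k != l -> [disjoint B k & B l],
      \bigcup_(k < n) B k = [set: 'I_n]
    & forall k, packable (B k)].

Definition used_bins (B : 'I_n -> {set 'I_n}) : nat :=
  #|[pred k | B k != finset.set0]|.

Definition is_opt (m : nat) : Prop :=
  (exists2 B, bin_packing B & used_bins B = m) /\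
  (forall B, bin_packing B -> (m <= used_bins B)%N).

(* OPT is 0 by convention on infeasible instances; OPTP shows that it is the
   minimum on all others. *)
Definition OPT : nat := xget 0%N [set m | is_opt m]%classic.

Lemma OPTP : (exists B, bin_packing B) -> is_opt OPT.
Proof.
move=> [B0 B0P].
have exm : exists m, `[< exists2 B, bin_packing B & used_bins B = m >].
  by exists (used_bins B0); apply/asboolP; exists B0.
have := ex_minnP exm; case=> m /asboolP mP m_min.
apply: (@xgetPex _ 0%N [set m | is_opt m]%classic).
exists m; split=> // B BP; apply: m_min.
by apply/asboolP; exists B.
Qed.

End Packing.

(* Main.v *)
Require Import Defs.
From mathcomp Require Import all_boot all_order all_algebra.
From mathcomp Require Import boolp classical_sets reals.
From mathcomp Require Import lra.

Set Implicit Arguments.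
Unset Strict Implicit.
Unset Printing Implicit Defensive.

Import Order.TTheory GRing.Theory Num.Theory.
Local Open Scope ring_scope.

(** Two items adjacent in every [G i] have sides adding up to more than 1 in
    every dimension, so in a unit cube their projections overlap in every
    dimension and hence their interiors meet. A bin therefore holds at most one
    item of a clique of the intersection graph. Independence of singletons
    bounds every side by 1, so some packing exists and [OPT] is a genuine
    minimum rather than its default value. *)

Section GraphEquivalence.
Variables (n : nat) (J : bp_instance n) (V : finType) (H : sgraph V).
Variable (v : 'I_n -> V).
Hypothesis equivH : equivalent_via J H v.

(** Irreflexivity of [adj H] makes the image of a singleton independent, and the weighted sum over a
    singleton is the size of its item. *)
Lemma equivalent_size_le1 j : bp_size J j <= 1.
Proof.
have [_ /(_ [set j]%SET) [_ szP]] := equivH.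
have sumE : \sum_(k < n) bp_size J k * (k \in [set j]%SET)%:R = bp_size J j.
  rewrite (bigD1 j) //= inE eqxx mulr1 big1 ?addr0 // => k kj.
  by rewrite inE (negbTE kj) mulr0.
rewrite -sumE; apply: szP.
apply/forall_inP => x; rewrite imset_set1 inE => /eqP->.
by apply/forall_inP => y; rewrite inE => /eqP->; rewrite adj_irrefl.
Qed.

(** Were the sum at most 1, the equivalence applied to the pair of items would make two adjacent
    vertices independent. *)
Lemma equivalent_adj_size_gt1 j k : j != k -> adj H (v j) (v k) ->
  1 < bp_size J j + bp_size J k.
Proof.
move=> jk adjjk; rewrite ltNge; apply/negP => le1.
have [_ /(_ [set j; k]%SET) [indep _]] := equivH.
have sumE : \sum_(l < n) bp_size J l * (l \in [set j; k]%SET)%:R =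
    bp_size J j + bp_size J k.
  rewrite (bigD1 j) // (bigD1 k) /=; last by rewrite eq_sym.
  rewrite !inE !eqxx orbT !mulr1 big1 ?addr0 // => l /andP[lj lk].
  by rewrite !inE (negbTE lj) (negbTE lk) mulr0.
rewrite sumE in indep.
have /forall_inP/(_ (v j)) := indep le1.
rewrite imset_f ?inE ?eqxx // => /(_ isT)/forall_inP/(_ (v k)).
by rewrite imset_f ?inE ?eqxx ?orbT // adjjk => /(_ isT).
Qed.

End GraphEquivalence.

Section PackingFacts.
Variables (R : realType) (n d : nat) (I : dbp_instance n d).

(** The two bounds come from the lowest and the highest corner, which lie in the closed box because
    sides are positive. *)
Lemma item_box_sub_cube j (p : 'rV[R]_d) i :
  (item_box I j p `<=` @unit_cube R d)%classic ->
  0 <= p 0 i /\ p 0 i + ratr (side I i j) <= 1.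
Proof.
have s0 l : 0 < ratr (side I l j) :> R by rewrite ltr0q side_gt0.
move=> sub; split.
  have /sub/(_ i)/andP[] // : item_box I j p p.
  by move=> l; have := s0 l; lra.
have /sub/(_ i)/andP[_] : item_box I j p (\row_l (p 0 l + ratr (side I l j))).
  by move=> l; rewrite mxE; have := s0 l; lra.
by rewrite mxE.
Qed.

Lemma packable_set1 j : (forall i, side I i j <= 1) -> packable R I [set j]%SET.
Proof.
move=> le1; exists (fun=> 0); split=> [k | k l]; rewrite !inE => /eqP->.
  move=> x xP i; have := xP i; rewrite mxE.
  have : ratr (side I i j) <= 1 :> R by rewrite -(rmorph1 (@ratr R)) ler_rat.
  lra.
by move=> /eqP->; rewrite eqxx.
Qed.

Lemma packable_eq A j k : packable R I A -> j \in A -> k \in A ->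
  (forall i, 1 < side I i j + side I i k) -> j = k.
Proof.
move=> [p [sub disj]] jA kA gt1; apply/eqP/negPn/negP => jk.
have /seteqP[+ _] := disj _ _ jA kA jk.
pose s i : R := ratr (side I i j); pose t i : R := ratr (side I i k).
(* Coordinatewise midpoint of the intersection of the two projected intervals. *)
pose x : 'rV[R]_d := \row_i
  ((Num.max (p j 0 i) (p k 0 i) + Num.min (p j 0 i + s i) (p k 0 i + t i)) / 2).
have overlap i : p j 0 i < x 0 i < p j 0 i + s i /\
                 p k 0 i < x 0 i < p k 0 i + t i.
  have [pj0 pj1] := item_box_sub_cube i (sub _ jA).
  have [pk0 pk1] := item_box_sub_cube i (sub _ kA).
  have s0 : 0 < s i by rewrite ltr0q side_gt0.
  have t0 : 0 < t i by rewrite ltr0q side_gt0.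
  have st1 : 1 < s i + t i.
    by rewrite -rmorphD -(rmorph1 (@ratr R)) ltr_rat gt1.
  rewrite -/(s i) in pj1; rewrite -/(t i) in pk1.
  rewrite mxE.
  (* The intersection has positive length: [p j 0 i <= 1 - s i < t i <= p k 0 i + t i], and
     symmetrically in [j] and [k]. *)
  case: (leP (p j 0 i) (p k 0 i)) => ?;
    case: (leP (p j 0 i + s i) (p k 0 i + t i)) => ?; split; lra.
by move/(_ x); apply; split=> i; have [] := overlap i.
Qed.

Lemma exists_bin_packing :
  (forall i j, side I i j <= 1) -> exists B, bin_packing R I B.
Proof.
move=> le1; exists (fun j => [set j]%SET); split=> [k l kl | | k].
- by rewrite disjoints1 inE.
- by apply/setP => j; rewrite inE; apply/bigcupP; exists j; rewrite ?inE.
- by apply: packable_set1 => i; apply: le1.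
Qed.

(** Sending each item to a bin that contains it is injective on [A] by [packable_eq], and its values
    are non-empty bins. *)
Lemma used_bins_ge B (A : {set 'I_n}) : bin_packing R I B ->
    (forall j k, j \in A -> k \in A -> j != k ->
       forall i, 1 < side I i j + side I i k) ->
  (#|A| <= used_bins B)%N.
Proof.
move=> [_ cov pack] gt1.
have /choice[f fP] : forall j, exists k, j \in B k.
  move=> j; have : j \in \bigcup_(k < n) B k by rewrite cov inE.
  by case/bigcupP=> k _ jk; exists k.
have f_inj : {in A &, injective f}.
  move=> j k jA kA fjk; apply/eqP/negPn/negP => jk.
  have kB : k \in B (f j) by rewrite fjk.
  have jkE := packable_eq (pack (f j)) (fP j) kB (gt1 _ _ jA kA jk).
  by rewrite jkE eqxx in jk.
rewrite -(card_in_imset f_inj); apply: subset_leq_card.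
apply/fintype.subsetP => _ /imsetP[j _ ->].
by rewrite inE; apply/set0Pn; exists j.
Qed.

End PackingFacts.

Theorem theorem4p35 (R : realType) (n d : nat) (d_gt0 : (0 < d)%N)
    (I : dbp_instance n d) (V : finType) (v : 'I_n -> V)
    (G : 'I_d -> sgraph V)
    (equivG : forall i : 'I_d, equivalent_via (dim_instance I i) (G i) v) :
  (clique_number (inter_graph d_gt0 G) <= OPT R I)%N.
Proof.
have le1 i j : side I i j <= 1 by apply: (equivalent_size_le1 (equivG i)).
(* One item per bin is feasible, so [OPT] is attained by some packing [B], whose used bins are to be
   counted. *)
have [[B packB <-] _] := OPTP (exists_bin_packing R le1).
apply/bigmax_leqP => K /forall_inP cliqueK.
have [v_bij _] := equivG (Ordinal d_gt0).
(* The clique is pulled back along the bijection [v] to a set of items of the same cardinality. *)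
rewrite -(on_card_preimset (f := v) (R := K)); last exact: onW_bij.
apply: (used_bins_ge packB) => j k; rewrite !inE => jK kK jk i.
apply: (equivalent_adj_size_gt1 (equivG i) jk).
have /forall_inP/(_ _ kK)/implyP := cliqueK _ jK.
by rewrite (inj_eq (bij_inj v_bij)) => /(_ jk)/forallP.
Qed.
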